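(* Let $\{A^i\}_{i=1}^N$ and $\{\tilde A^i\}_{i=1}^N$ be injective fMPSs of bond dimension $2n$ with Wall invariant $(-)$, both in canonical form, with Wall matrices $u$ and $\tilde u$. Then $\{A^i\}_i\sim\{\tilde A^i\}_i$ holds if and only if there exist $V\in\mathrm U(2n)$ and $e^{i\beta}\in\mathrm U(1)$ with $$\tilde A^i = e^{i\beta}V^\dagger A^i V\quad\text{for all } i.$$ The phase $e^{i\beta}$ is unique, and $V$ is unique up to replacements $V\mapsto e^{i\theta u}Ve^{i\phi\tilde u}$ with $\theta,\phi\in\mathbb R$. Moreover $\tilde u = \eta V^\dagger uV$ for some sign $\eta\in\{\pm1\}$. All of these statements remain true if the hypothesis $\{A^i\}_i\sim\{\tilde A^i\}_i$ is replaced by $\{A^i\}_i\sim_{\rm PBC}\{\tilde A^i\}_i$.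
   Context: Fix integers $N,n\ge1$ and a parity function $i\mapsto|i|\in\{0,1\}$ on $\{1,\dots,N\}$; $\sigma_x,\sigma_z$ are Pauli matrices. An fMPS of bond dimension $2n$ is a tuple $\{A^i\}_{i=1}^N$ of complex $2n\times2n$ matrices for which some $Z$ unitarily equivalent to $\sigma_z\otimes1_n$ satisfies $(-1)^{|i|}A^i=ZA^iZ$ for all $i$; canonical form means $\sum_iA^iA^{i\dagger}=1_{2n}$. It is injective with Wall invariant $(-)$ if there exist a unitary $W\in\mathrm U(2n)$ and complex $n\times n$ matrices $B^i$ with $A^i=W(\sigma_x^{|i|}\otimes B^i)W^\dagger$ for all $i$, and a fixed $l\in\mathbb N$ such that both $\{B^{i_1}\cdots B^{i_l}:\sum_k|i_k|\equiv0 \bmod 2\}$ and $\{B^{i_1}\cdots B^{i_l}:\sum_k|i_k|\equiv1\bmod 2\}$ span $\mathrm M_n(\mathbb C)$. Its Wall matrix is $u=W(\sigma_x\otimes1_n)W^\dagger$ (unique up to sign). Gauge equivalence: $\{A^i\}\sim\{\tilde A^i\}$ iff for each $L\in\mathbb N$ there is $\alpha_L$ with $\mathrm{tr}[A^{i_1}\cdots A^{i_L}]=e^{i\alpha_L}\mathrm{tr}[\tilde A^{i_1}\cdots\tilde A^{i_L}]$ for all $i_1,\dots,i_L$; $\{A^i\}\sim_{\rm PBC}\{\tilde A^i\}$ iff for each $L$ there is $\alpha_L$ with $\mathrm{tr}[uA^{i_1}\cdots A^{i_L}]=e^{i\alpha_L}\mathrm{tr}[\tilde u\tilde A^{i_1}\cdots\tilde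 A^{i_L}]$ for all $i_1,\dots,i_L$.
   Formalization: V is shown unique up to V ↦ e^{iψ}e^{iθu}Ve^{iφũ} with an extra global phase e^{iψ}; without it the uniqueness fails, since iV gives the same conjugation as V but is not of the form e^{iθu}Ve^{iφũ}. *)

(* Defs.v *)
From HB Require Import structures.
From mathcomp Require Import all_boot all_order all_algebra.
From mathcomp Require Import complex mxtens.
From mathcomp Require Import reals trigo.
Set Implicit Arguments. Unset Strict Implicit. Unset Printing Implicit Defensive.
Import Order.TTheory GRing.Theory Num.Theory.
Local Open Scope ring_scope.
Local Open Scope complex_scope.

Section FMPS.
Variable R : realType.
Local Notation C := R[i].

Definition adj {m k} (M : 'M[C]_(m, k)) : 'M[C]_(k, m) := map_mx (@conjc R) M^T.

Definition unitary {m} (U : 'M[C]_m) : Prop := U *m adj U = 1%:M /\ adj U *m U = 1%:M.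

Definition expi (a : R) : C := (cos a) +i* (sin a).

(* e^{i theta u} for a Wall matrix u (u^2 = 1): cos theta 1 + i sin theta u *)
Definition expiu {m} (theta : R) (u : 'M[C]_m) : 'M[C]_m :=
  ((cos theta)%:C) *: 1%:M + ((sin theta)*i) *: u.

Definition sigma_x : 'M[C]_2 := \matrix_(i < 2, j < 2) (if i == j then 0 else 1).
Definition sigma_z : 'M[C]_2 :=
  \matrix_(i < 2, j < 2) (if i == j then (if i == 0%N :> nat then 1 else -1) else 0).

Definition mxword {N m} (A : 'I_N -> 'M[C]_m) {L} (s : {ffun 'I_L -> 'I_N}) : 'M[C]_m :=
  \big[mulmx/1%:M]_(k < L) A (s k).

Definition wpar {N} (par : 'I_N -> bool) {L} (s : {ffun 'I_L -> 'I_N}) : bool :=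
  odd (\sum_(k < L) par (s k)).

Definition is_fMPS {N} n (par : 'I_N -> bool) (A : 'I_N -> 'M[C]_(2 * n)) : Prop :=
  exists Z : 'M[C]_(2 * n),
    (exists W : 'M[C]_(2 * n), unitary W /\ Z = W *m (sigma_z *t (1%:M : 'M[C]_n)) *m adj W)
    /\ forall i, ((-1) ^+ par i) *: A i = Z *m A i *m Z.

Definition fMPS_canonical {N m} (A : 'I_N -> 'M[C]_m) : Prop :=
  \sum_(i < N) A i *m adj (A i) = 1%:M.

Definition spans_parity {N} n (par : 'I_N -> bool) (B : 'I_N -> 'M[C]_n) (l : nat) (b : bool) : Prop :=
  forall M : 'M[C]_n, exists c : {ffun 'I_l -> 'I_N} -> C,
    M = \sum_(s : {ffun 'I_l -> 'I_N} | wpar par s == b) c s *: mxword B s.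

(* {A^i} is injective with Wall invariant (-) and u is a Wall matrix for it *)
Definition wall_minus {N} n (par : 'I_N -> bool) (A : 'I_N -> 'M[C]_(2 * n))
    (u : 'M[C]_(2 * n)) : Prop :=
  exists W : 'M[C]_(2 * n), exists B : 'I_N -> 'M[C]_n,
    [/\ unitary W,
        forall i, A i = W *m ((if par i then sigma_x else 1%:M) *t B i) *m adj W,
        exists l, spans_parity par B l false /\ spans_parity par B l true
      & u = W *m (sigma_x *t (1%:M : 'M[C]_n)) *m adj W].

Definition gauge_equiv {N m} (A At : 'I_N -> 'M[C]_m) : Prop :=
  forall L : nat, exists alpha : R, forall s : {ffun 'I_L -> 'I_N},
    \tr (mxword A s) = expi alpha * \tr (mxword At s).

Definition gauge_equiv_PBC {N m} (A At : 'I_N -> 'M[C]_m) (u ut : 'M[C]_m) : Prop :=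
  forall L : nat, exists alpha : R, forall s : {ffun 'I_L -> 'I_N},
    \tr (u *m mxword A s) = expi alpha * \tr (ut *m mxword At s).

Definition related {N m} (A At : 'I_N -> 'M[C]_m) (V : 'M[C]_m) (beta : R) : Prop :=
  unitary V /\ forall i, At i = expi beta *: (adj V *m A i *m V).

End FMPS.

(* Main.v *)
Require Import Defs.
From HB Require Import structures.
From mathcomp Require Import all_boot all_order all_algebra spectral sesquilinear.
From mathcomp Require Import complex mxtens ring.
From mathcomp Require Import boolp reals trigo.
Set Implicit Arguments. Unset Strict Implicit. Unset Printing Implicit Defensive.
Import Order.TTheory GRing.Theory Num.Theory.
Local Open Scope ring_scope.
Local Open Scope sesquilinear_scope.

(** Up to conjugation by [W], a word in the [A i] is [sigma_x^p] tensored with the same word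
    in the [B i], [p] being its parity.  Its trace, without or with the Wall matrix inserted,
    is therefore twice the trace of the [B]-word if the parity is even, respectively odd, and
    zero otherwise, so each gauge equivalence compares the traces of the [B]- and [B']-words
    of one fixed parity [b0].

    For large [L] the words of length [L] and parity [b] span all matrices.  Pairing with the
    words of parity [b + b0] in the trace form shows that sending each [B]-word to the
    [B']-word with the same letters is a well-defined linear map, multiplicative across
    lengths and parities.  It sends [1] to a central element, i.e. to a scalar, which the
    trace condition makes unimodular; after dividing by this scalar, Skolem-Noether gives
    [B' i = lam (-1)^(k |i|) T^-1 (B i) T].  The sign is absorbed by [sigma_z].  Since both
    families are canonical, [T T^*] is a fixed point of [X |-> \sum_i B_i X B_i^*], hence a
    scalar, so [T] is a multiple of a unitary.

    For uniqueness, if [X A_i = z A_i X] with [X != 0], then comparing the words of lengths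
    [l] and [l + 1] gives [z = 1]; and the commutant of the [A_i] is spanned by [1] and [u],
    whose unitary elements are the [e^(i psi) e^(i theta u)]. *)

Lemma eq_sqr_sign (R : idomainType) (x y : R) :
  x ^+ 2 = y ^+ 2 -> exists k : bool, x = (-1) ^+ k * y.
Proof.
move/eqP; rewrite eqf_sqr => /orP[]/eqP->; first by exists false; rewrite mul1r.
by exists true; rewrite mulN1r.
Qed.

Section MatrixAlgebra.
Variable R : comNzRingType.

Lemma mxtrace_mul_delta m n (X : 'M[R]_(m, n)) i j : \tr (X *m delta_mx i j) = X j i.
Proof.
by rewrite -(mul_delta_mx (0 : 'I_1)) mulmxA -colE mxtrace_mulC -rowE trace_mx11 !mxE.
Qed.

Lemma mxtrace_mul_eq0 m n (X : 'M[R]_(m, n)) : (forall Y, \tr (X *m Y) = 0) -> X = 0.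
Proof. by move=> trX; apply/matrixP=> i j; rewrite mxE -(mxtrace_mul_delta X) trX. Qed.

Lemma cent_mx_is_scalar n (X : 'M[R]_n) : (forall Y, comm_mx X Y) -> is_scalar_mx X.
Proof.
case: n X => [|n] X comX; apply/is_scalar_mxP; first by exists 0; apply/matrixP=> [[]].
exists (X 0 0); apply/matrixP=> i j.
rewrite -(mxtrace_mul_delta X j i) -(mul_delta_mx (0 : 'I_n.+1)) mulmxA comX.
rewrite -mulmxA mxtrace_mulC -mulmxA mul_delta_mx_cond !raddfMn /= mxtrace_mul_delta.
by rewrite mxE eq_sym.
Qed.

End MatrixAlgebra.

Lemma rmorph_delta_mx_neq0 (R S : nzRingType) n (f : {rmorphism 'M[R]_n.+1 -> S}) i j :
  f (delta_mx i j) != 0.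
Proof.
apply/eqP=> f0; have /eqP := rmorph1 f; rewrite -[X in f X]/(1%:M) mx1_sum_delta.
rewrite raddf_sum big1 ?(eq_sym 0) ?oner_eq0 // => k _.
rewrite -(mul_delta_mx i) -[delta_mx i k](mul_delta_mx j).
by rewrite !mulmxE /= !rmorphM /= f0 mul0r mulr0.
Qed.

(* The intertwiner is [u |-> v f(e_0^T u)], for a row vector [v] that [f (e_0^T e_0)] does
   not annihilate. *)
Lemma Skolem_Noether_mx (F : fieldType) n (f : {lrmorphism 'M[F]_n.+1 -> 'M[F]_n.+1}) :
  exists2 T, T \in unitmx & forall X, f X = invmx T *m X *m T.
Proof.
have /rowV0Pn[_ /submxP[v ->] vf0] := rmorph_delta_mx_neq0 f 0 0.
pose e : 'cV[F]_n.+1 := delta_mx 0 0; pose g u := v *m f (e *m u).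
have g_lin : linear g by move=> a x y; rewrite /g mulmxDr -scalemxAr linearP mulmxDr -scalemxAr.
pose gL : {linear _ -> _} := HB.pack g (GRing.isLinear.Build _ _ _ _ g g_lin).
pose T := lin1_mx gL; have mulT u : u *m T = v *m f (e *m u) by exact: mul_rV_lin1.
have mulTf (u : 'rV_n.+1) X : u *m X *m T = u *m T *m f X.
  by rewrite !mulT mulmxA mulmxE rmorphM /= -mulmxE mulmxA.
have Tu : T \in unitmx.
  rewrite -row_free_unit; apply: inj_row_free => u uT0.
  apply: contraNeq vf0 => /rV0Pn[k uk0].
  have -> : delta_mx 0 0 = e *m (u *m ((u 0 k)^-1 *: delta_mx k 0)) :> 'M_n.+1.
    rewrite -[delta_mx k 0](mul_delta_mx (0 : 'I_1)) -scalemxAr mulmxA -colE.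
    by rewrite [col k u]mx11_scalar mxE mul_scalar_mx scalerA mulVf // scale1r mul_delta_mx.
  by rewrite -mulT mulTf uT0 mul0mx.
exists T => // X; apply: (can_inj (mulKmx Tu)); rewrite mulmxA mulKVmx //.
by apply/row_matrixP=> i; rewrite !rowE !mulmxA mulTf.
Qed.

HB.instance Definition _ (R : pzSemiRingType) n := Monoid.isLaw.Build 'M[R]_n 1%:M mulmx
  (@mulmxA R n n n n) (@mul1mx R n n) (@mulmx1 R n n).

Section Words.
Variables (R : comNzRingType) (I : Type) (par : I -> bool).

Definition word n (B : I -> 'M[R]_n) (t : seq I) : 'M[R]_n := \big[mulmx/1%:M]_(i <- t) B i.

Definition parity (t : seq I) : bool := \big[addb/false]_(i <- t) par i.

Inductive same_comb n m (B : I -> 'M[R]_n) (B' : I -> 'M[R]_m) (b : bool) (L : nat) :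
    'M[R]_n -> 'M[R]_m -> Prop :=
| same_comb0 : same_comb B B' b L 0 0
| same_comb_cons a t X Y of size t = L & parity t = b & same_comb B B' b L X Y :
    same_comb B B' b L (a *: word B t + X) (a *: word B' t + Y).

Definition words_span n (B : I -> 'M[R]_n) b L := forall X, same_comb B B b L X X.

Section Pair.
Variables (n m : nat) (B : I -> 'M[R]_n) (B' : I -> 'M[R]_m).
Local Notation same := (same_comb B B').

Lemma same_comb_sym b L X Y : same b L X Y -> same_comb B' B b L Y X.
Proof. by elim=> *; constructor. Qed.

Lemma same_comb_word t : same (parity t) (size t) (word B t) (word B' t).
Proof.
have := @same_comb_cons _ _ B B' _ _ 1 t 0 0 erefl erefl (same_comb0 _ _ _ _).
by rewrite !scale1r !addr0.
Qed.

Lemma same_comb_letter i : same (par i) 1 (B i) (B' i).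
Proof. by have := same_comb_word [:: i]; rewrite /parity /word !big_seq1. Qed.

Lemma same_comb_linear b L a X Y X' Y' : same b L X Y -> same b L X' Y' ->
  same b L (a *: X + X') (a *: Y + Y').
Proof.
elim=> [|c t X0 Y0 t_size t_par _ IH] sameXY'; first by rewrite !scaler0 !add0r.
by rewrite !scalerDr !scalerA -!addrA; constructor=> //; apply: IH.
Qed.

Lemma same_comb_sum (J : Type) (r : seq J) b L (X : J -> 'M_n) (Y : J -> 'M_m) :
  (forall j, same b L (X j) (Y j)) -> same b L (\sum_(j <- r) X j) (\sum_(j <- r) Y j).
Proof.
move=> sameXY; elim: r => [|j r IH]; rewrite ?big_nil ?big_cons; first by constructor.
by rewrite -[X j]scale1r -[Y j]scale1r; apply: same_comb_linear.
Qed.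

Lemma same_combM b L b' L' X Y X' Y' : same b L X Y -> same b' L' X' Y' ->
  same (b (+) b') (L + L') (X *m X') (Y *m Y').
Proof.
move=> + sameXY'; elim=> [|a t X0 Y0 <- <- _ IH]; first by rewrite !mul0mx; constructor.
rewrite !mulmxDl -!scalemxAl; apply: same_comb_linear IH.
elim: sameXY' => [|c s X1 Y1 <- <- _ IH]; first by rewrite !mulmx0; constructor.
rewrite !mulmxDr -!scalemxAr; apply: same_comb_linear IH.
by have := same_comb_word (t ++ s); rewrite /parity /word !big_cat size_cat.
Qed.

Lemma same_comb_transfer b L X X' : same_comb B B b L X X' -> exists Y, same b L X Y.
Proof.
elim=> [|a t X0 Y0 t_size t_par _ [Y sameXY]]; first by exists 0; constructor.
by exists (a *: word B' t + Y); constructor.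
Qed.

Lemma same_comb_mxtrace c b L X Y : same b L X Y ->
    (forall t, size t = L -> parity t = b -> \tr (word B t) = c * \tr (word B' t)) ->
  \tr X = c * \tr Y.
Proof.
move=> + trB; elim=> [|a t X0 Y0 t_size t_par _ IH]; first by rewrite !mxtrace0 mulr0.
by rewrite !mxtraceD !mxtraceZ IH trB // mulrDr mulrCA.
Qed.

End Pair.

Lemma words_span_ind n (B : I -> 'M[R]_n) b L (P : 'M[R]_n -> Prop) :
    words_span B b L -> P 0 ->
    (forall a t X, size t = L -> parity t = b -> P X -> P (a *: word B t + X)) ->
  forall X, P X.
Proof. by move=> spanB P0 PS X; elim: (spanB X) => // a t {}X Y t_size t_par _; apply: PS. Qed.

Lemma intertwiner_word n m (B : I -> 'M[R]_n) (B' : I -> 'M[R]_m) (X : 'M_(n, m)) z t :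
    (forall i, X *m B' i = z *: (B i *m X)) ->
  X *m word B' t = z ^+ size t *: (word B t *m X).
Proof.
move=> XB'; rewrite /word; elim: t => [|i t IH].
  by rewrite !big_nil mulmx1 mul1mx scale1r.
by rewrite !big_cons mulmxA XB' -scalemxAl -mulmxA IH -scalemxAr scalerA mulmxA exprS.
Qed.

Definition mx_generates n (B : I -> 'M[R]_n) : Prop :=
  forall P : 'M[R]_n -> Prop, P 1%:M ->
    (forall a X Y, P X -> P Y -> P (a *: X + Y)) -> (forall X Y, P X -> P Y -> P (X *m Y)) ->
    (forall i, P (B i)) -> forall X, P X.

Lemma words_span_generates n (B : I -> 'M[R]_n) b L : words_span B b L -> mx_generates B.
Proof.
move=> spanB P P1 PD PM PB; apply: (words_span_ind spanB) => [|a t X _ _ PX].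
  by have := PD (-1) _ _ P1 P1; rewrite scaleN1r addNr.
by apply: PD PX; elim/big_ind: (word B t).
Qed.

Lemma mx_generates_conj n (B : I -> 'M[R]_n) (T T' : 'M[R]_n) : T *m T' = 1%:M ->
  mx_generates B -> mx_generates (fun i => T *m B i *m T').
Proof.
move=> TT' genB P P1 PD PM PB X.
suff: P (T *m (T' *m X *m T) *m T') by rewrite !mulmxA TT' mul1mx -mulmxA TT' mulmx1.
apply: (genB (fun Y => P (T *m Y *m T'))) => // [|a Y Z PY PZ|Y Z PY PZ].
- by rewrite mulmx1 TT'.
- by rewrite mulmxDr mulmxDl -scalemxAr -scalemxAl; apply: PD.
- by have := PM _ _ PY PZ; rewrite !mulmxA -(mulmxA _ T') (mulmx1C TT') mulmx1.
Qed.

End Words.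

Section RightInvertible.
Variables (R : comNzRingType) (I : finType) (par : I -> bool) (n : nat).
Variables (B B' : I -> 'M[R]_n).
Hypothesis sumBB' : \sum_i B i *m B' i = 1%:M.

Lemma words_spanS L :
  (forall b, words_span par B b L) -> forall b, words_span par B b L.+1.
Proof.
move=> spanB b X; rewrite -[X]mul1mx -sumBB' mulmx_suml.
apply: same_comb_sum => i; rewrite -mulmxA -add1n -[b](addKb (par i)).
by apply: same_combM (spanB _ _); apply: same_comb_letter.
Qed.

Lemma words_span_leq L L' : (L <= L')%N ->
  (forall b, words_span par B b L) -> forall b, words_span par B b L'.
Proof. by move=> /subnK<- spanB; elim: (L' - L)%N => // k; rewrite addSn; apply: words_spanS. Qed.

End RightInvertible.

Section ProportionalTraces.
Variables (F : numFieldType) (I : Type) (par : I -> bool) (n : nat) (B B' : I -> 'M[F]_n.+1).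
Variables (l : nat) (b0 : bool) (e : nat -> F).
Hypothesis spanB : forall b L, (l <= L)%N -> words_span par B b L.
Hypothesis spanB' : forall b L, (l <= L)%N -> words_span par B' b L.
Hypothesis norm_e : forall L, `|e L| = 1.
Hypothesis tr_word : forall t, parity par t = b0 ->
  \tr (word B t) = e (size t) * \tr (word B' t).

Local Notation same := (same_comb par B B').

Lemma same_comb_tr L X Y : same b0 L X Y -> \tr X = e L * \tr Y.
Proof. by move/same_comb_mxtrace; apply=> t <- /tr_word. Qed.

(* Multiplying by words of parity [b + b0] makes the traces comparable. *)
Lemma same_comb_inj b L X Y Y' : (l <= L)%N -> same b L X Y -> same b L X Y' -> Y = Y'.
Proof.
move=> lL sameY sameY'; apply/eqP; rewrite -subr_eq0; apply/eqP/mxtrace_mul_eq0 => Z.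
have [Z' /same_comb_sym sameZ] := same_comb_transfer B (spanB' (b (+) b0) lL Z).
have := same_combM (same_comb_linear (-1) sameY' sameY) sameZ.
rewrite !scaleN1r !addNr mul0mx addKb [- Y' + Y]addrC => /same_comb_tr/esym/eqP.
by rewrite mxtrace0 mulf_eq0 -normr_eq0 norm_e oner_eq0 => /eqP.
Qed.

Lemma same_comb_exists b L X : (l <= L)%N -> exists Y, same b L X Y.
Proof. by move=> lL; apply: same_comb_transfer (spanB b lL X). Qed.

(* The partner of [1] is central because [1 X = X 1]. *)
Lemma same_comb1_scalar b L : (l <= L)%N -> exists c, same b L 1%:M c%:M.
Proof.
move=> lL; have [Y sameY] := same_comb_exists b 1%:M lL.
suff /is_scalar_mxP[c YE] : is_scalar_mx Y by exists c; rewrite -YE.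
apply: cent_mx_is_scalar => Z.
have [X /same_comb_sym sameX] := same_comb_transfer B (spanB' b lL Z).
have := same_combM sameY sameX; have := same_combM sameX sameY; rewrite mulmx1 mul1mx.
by move=> sameZY sameYZ; apply: same_comb_inj sameYZ sameZY; rewrite (leq_trans lL) ?leq_addr.
Qed.

Lemma same_comb1_norm b L c : (l <= L)%N -> same b L 1%:M c%:M -> `|c| = 1.
Proof.
have b0_norm L' c' : same b0 L' 1%:M c'%:M -> `|c'| = 1.
  move/same_comb_tr; rewrite !mxtrace_scalar -[c' *+ _]mulr_natr mulrA -[LHS]mul1r.
  have n_neq0 : n.+1%:R != 0 :> F by rewrite pnatr_eq0.
  by move/(mulIf n_neq0)/(congr1 Num.norm); rewrite normrM norm_e mul1r normr1.
move=> lL sameb; have [d sameb0] := same_comb1_scalar b0 lL.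
have := same_combM (same_combM sameb sameb) sameb0.
rewrite !mulmx1 addbb -!scalar_mxM => /b0_norm.
rewrite !normrM (b0_norm _ _ sameb0) mulr1 -expr2 => /eqP.
by rewrite pexpr_eq1 // => /eqP.
Qed.

Lemma same_comb_automorphism c : c != 0 -> same false l 1%:M c%:M ->
  exists f : {lrmorphism 'M[F]_n.+1 -> 'M[F]_n.+1}, forall X, same false l X (c *: f X).
Proof.
move=> c0 same1; have ll := leq_addr l l.
have /choice[f fP] X : exists Y, same false l X (c *: Y).
  have [Y sameY] := same_comb_exists false X (leqnn l).
  by exists (c^-1 *: Y); rewrite scalerA divff ?scale1r.
have f_lin : linear f.
  move=> a X Y; apply: (scalerI c0); rewrite scalerDr scalerA mulrC -scalerA.
  by apply: same_comb_inj (leqnn l) (fP _) (same_comb_linear a (fP X) (fP Y)).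
have f_mon : monoid_morphism f.
  split=> [|X Y]; apply: (scalerI c0).
    by rewrite scalemx1; apply: same_comb_inj (leqnn l) (fP _) same1.
  apply: (scalerI c0); have := same_combM (fP X) (fP Y); have := same_combM (fP (X * Y)) same1.
  rewrite mulmx1 mul_mx_scalar -scalemxAl -scalemxAr => sameXY1 sameXY.
  exact: same_comb_inj ll sameXY1 sameXY.
pose fL := GRing.isLinear.Build _ _ _ _ f f_lin.
pose fM := GRing.isMonoidMorphism.Build _ _ f f_mon.
pose g : {lrmorphism 'M[F]_n.+1 -> 'M[F]_n.+1} := HB.pack f fL fM.
by exists g.
Qed.

Lemma proportional_traces_similar : exists (T : 'M[F]_n.+1) (lam : bool -> F),
  [/\ T \in unitmx, forall b, `|lam b| = 1, lam true ^+ 2 = lam false ^+ 2 &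
      forall i, B' i = lam (par i) *: (invmx T *m B i *m T)].
Proof.
have [c same1] := same_comb1_scalar false (leqnn l).
have c_norm := same_comb1_norm (leqnn l) same1.
have c0 : c != 0 by rewrite -normr_eq0 c_norm oner_eq0.
have [f fP] := same_comb_automorphism c0 same1.
have [T Tu fE] := Skolem_Noether_mx f.
have /choice[d same_d] b := same_comb1_scalar b (leqnSn l).
have l_le : (l <= l.+1 + l.+1)%N by rewrite (leq_trans (leqnSn l)) ?leq_addr.
exists T, (fun b => d b / c); split=> // [b||i].
- by rewrite normrM normfV c_norm (same_comb1_norm (leqnSn l) (same_d b)) invr1 mulr1.
- have := same_combM (same_d true) (same_d true).
  have := same_combM (same_d false) (same_d false); rewrite mulmx1 -!scalar_mxM => sameF sameT.
  have /matrixP/(_ 0 0) := same_comb_inj l_le sameF sameT.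
  by rewrite !mxE !mulr1n -!expr2 !expr_div_n => ->.
have := same_combM (same_d (par i)) (fP (B i)).
have := same_combM (same_combM (same_comb_letter par B B' i) same1) same1.
rewrite !mulmx1 mul1mx !mul_mx_scalar mul_scalar_mx !addbF !addSn !add0n => sameB' same_f.
have l_leS : (l <= (l + l).+1)%N by rewrite leqW ?leq_addr.
have /(scalerI c0) cB' : c *: (c *: B' i) = c *: (d (par i) *: f (B i)).
  by rewrite (same_comb_inj l_leS sameB' same_f) !scalerA [c * _]mulrC.
by rewrite -fE mulrC -scalerA -cB' scalerA mulVf // scale1r.
Qed.

End ProportionalTraces.

Section ConjugateTranspose.
Variable C : numClosedFieldType.

Lemma trmxCM m n p (A : 'M[C]_(m, n)) (B : 'M[C]_(n, p)) : (A *m B)^t* = B^t* *m A^t*.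
Proof. by rewrite trmx_mul map_mxM. Qed.

Lemma trmxCD m n (A B : 'M[C]_(m, n)) : (A + B)^t* = A^t* + B^t*.
Proof. by rewrite linearD map_mxD. Qed.

Lemma trmxCZ m n a (A : 'M[C]_(m, n)) : (a *: A)^t* = a^* *: A^t*.
Proof. by rewrite linearZ map_mxZ. Qed.

Lemma trmxC1 n : (1%:M : 'M[C]_n)^t* = 1%:M.
Proof. by rewrite trmx1 map_mx1. Qed.

Lemma mul_trmxC_unitarymx n (U : 'M[C]_n) : U \is unitarymx -> U^t* *m U = 1%:M.
Proof. by move/unitarymxP/mulmx1C. Qed.

Lemma unitarymxZ m n a (U : 'M[C]_(m, n)) :
  `|a| = 1 -> U \is unitarymx -> a *: U \is unitarymx.
Proof.
move=> a1 /unitarymxP UU; apply/unitarymxP.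
by rewrite trmxCZ -scalemxAl -scalemxAr scalerA -normCK a1 expr1n scale1r.
Qed.

Lemma unitarymx_conjK n (U X : 'M[C]_n) : U \is unitarymx -> U^t* *m (U *m X *m U^t*) *m U = X.
Proof. by move=> Uu; rewrite !mulmxA mul_trmxC_unitarymx // mul1mx mulmxKtV. Qed.

Lemma mulmx_unitarymx_conj n (U X : 'M[C]_n) : U \is unitarymx -> U *m (U^t* *m X *m U) = X *m U.
Proof. by move=> Uu; rewrite !mulmxA (unitarymxP Uu) mul1mx. Qed.

Lemma mxtrace_unitarymx_conj n (U X : 'M[C]_n) : U \is unitarymx -> \tr (U^t* *m X *m U) = \tr X.
Proof. by move=> Uu; rewrite mxtrace_mulC mulmxA (unitarymxP _) // mul1mx. Qed.

Lemma congruence_trmxCM n (U V W X : 'M[C]_n) :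
  (U *m V *m W^t*)^t* *m X *m (U *m V *m W^t*) =
  W *m (V^t* *m (U^t* *m X *m U) *m V) *m W^t*.
Proof. by rewrite !trmxCM trmxCK !mulmxA. Qed.

Lemma mulmx_trmxC_diagE m n (A : 'M[C]_(m, n)) (d : 'rV_n) i :
  (A *m diag_mx d *m A^t*) i i = \sum_j d 0 j * `|A i j| ^+ 2.
Proof. by rewrite mxE; apply: eq_bigr => j _; rewrite mul_mx_diag !mxE normCK mulrCA mulrA. Qed.

End ConjugateTranspose.

Section TransferFixedPoints.
Variables (C : numClosedFieldType) (I : finType).

(* The matrices mapping row vectors supported where [d] vanishes to such row vectors form an
   algebra containing the [B i], hence contain everything. *)
Lemma transfer_fixed_diag_eq0 n (B : I -> 'M[C]_n) (d : 'rV_n) k :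
    mx_generates B -> (forall j, 0 <= d 0 j) -> d 0 k = 0 ->
    \sum_i B i *m diag_mx d *m (B i)^t* = diag_mx d ->
  d = 0.
Proof.
move=> genB d_ge0 dk0 fix_d.
pose stable (X : 'M[C]_n) := forall i j, d 0 i = 0 -> d 0 j != 0 -> X i j = 0.
have stableB i : stable (B i).
  move=> p q dp0 dq_neq0.
  have term_ge0 r s : 0 <= d 0 s * `|B r p s| ^+ 2 by rewrite mulr_ge0 ?exprn_ge0.
  have : \sum_r \sum_s d 0 s * `|B r p s| ^+ 2 = 0.
    transitivity (diag_mx d p p); last by rewrite mxE dp0 mul0rn.
    by rewrite -fix_d summxE; apply: eq_bigr => r _; rewrite mulmx_trmxC_diagE.
  move/psumr_eq0P => /(_ (fun r _ => sumr_ge0 _ (fun s _ => term_ge0 r s)) i isT).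
  move/psumr_eq0P => /(_ (fun s _ => term_ge0 i s) q isT)/eqP.
  by rewrite mulf_eq0 (negbTE dq_neq0) expf_eq0 normr_eq0 => /eqP.
apply/rowP=> j; rewrite mxE; apply/eqP/negP => /negP dj_neq0.
suff /(_ k j dk0 dj_neq0)/eqP : stable (delta_mx k j) by rewrite mxE !eqxx oner_eq0.
apply: genB => // [p q dp0 dq|a X Y stX stY p q dp0 dq|X Y stX stY p q dp0 dq].
- by rewrite mxE; case: (p =P q) dq => // <-; rewrite dp0 eqxx.
- by rewrite !mxE stX ?stY // mulr0 addr0.
rewrite mxE big1 // => r _; have [dr0|dr] := eqVneq (d 0 r) 0.
  by rewrite (stY r) ?mulr0.
by rewrite stX ?mul0r.
Qed.

Lemma transfer_fixed_diag_scalar n (B : I -> 'M[C]_n) (d : 'rV_n) :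
    mx_generates B -> \sum_i B i *m (B i)^t* = 1%:M -> d \is a realmx ->
    \sum_i B i *m diag_mx d *m (B i)^t* = diag_mx d ->
  is_scalar_mx (diag_mx d).
Proof.
case: n B d => [|n] B d genB canB /mxOverP d_real fix_d; apply/is_scalar_mxP.
  by exists 0; apply/matrixP=> [[]].
have [k _ d_min] := @real_arg_minP _ _ (0 : 'I_n.+1) xpredT (d 0) isT (fun j _ => d_real 0 j).
set mu := d 0 k in d_min; exists mu.
apply/eqP; rewrite -diag_const_mx -subr_eq0 -linearB /=.
rewrite (@transfer_fixed_diag_eq0 _ B (d - const_mx mu) k) ?linear0 // => [j||].
- by rewrite !mxE subr_ge0 d_min.
- by rewrite !mxE subrr.
rewrite linearB /= diag_const_mx.
under eq_bigr do rewrite mulmxBr mulmxBl mul_mx_scalar -scalemxAl.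
by rewrite sumrB fix_d -scaler_sumr canB scalemx1.
Qed.

Lemma transfer_fixed_hermitian_scalar n (B : I -> 'M[C]_n) (P : 'M_n) :
    mx_generates B -> \sum_i B i *m (B i)^t* = 1%:M ->
    P \is hermsymmx -> \sum_i B i *m P *m (B i)^t* = P ->
  is_scalar_mx P.
Proof.
move=> genB canB hermP fixP; pose Q := spectralmx P; pose d := spectral_diag P.
have Qu : Q \is unitarymx := spectral_unitarymx P.
have PE : P = Q^t* *m diag_mx d *m Q.
  by rewrite -invmx_unitary //; apply/orthomx_spectralP/hermitian_normalmx.
pose conjQ X := Q *m X *m Q^t*.
have sum_conjQ X : \sum_i conjQ (B i) *m conjQ X *m (conjQ (B i))^t* =
    conjQ (\sum_i B i *m X *m (B i)^t*).
  rewrite /conjQ mulmx_sumr mulmx_suml; apply: eq_bigr => i _.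
  by rewrite !trmxCM trmxCK !mulmxA !mulmxKtV.
have conjQP : conjQ P = diag_mx d.
  by rewrite /conjQ PE !mulmxA (unitarymxP _) // mul1mx mulmxtVK.
have conjQ1 : conjQ 1%:M = 1%:M by rewrite /conjQ mulmx1 (unitarymxP _).
have /is_scalar_mxP[mu dE] : is_scalar_mx (diag_mx d).
  apply: (@transfer_fixed_diag_scalar _ (conjQ \o B)).
  - by apply: mx_generates_conj genB; apply/unitarymxP.
  - transitivity (conjQ (\sum_i B i *m 1%:M *m (B i)^t*)).
      by rewrite -sum_conjQ conjQ1; apply: eq_bigr => i _; rewrite mulmx1.
    by under eq_bigr do rewrite mulmx1; rewrite canB.
  - exact: hermitian_spectral_diag_real.
  - by rewrite -conjQP sum_conjQ fixP.
apply/is_scalar_mxP; exists mu.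
by rewrite PE dE mul_mx_scalar -scalemxAl mul_trmxC_unitarymx // scalemx1.
Qed.

Lemma similar_canonical_unitary n (B B' : I -> 'M[C]_n) (T : 'M_n) (lam : I -> C) :
    mx_generates B -> \sum_i B i *m (B i)^t* = 1%:M -> \sum_i B' i *m (B' i)^t* = 1%:M ->
    T \in unitmx -> (forall i, `|lam i| = 1) ->
    (forall i, B' i = lam i *: (invmx T *m B i *m T)) ->
  exists2 v, v \is unitarymx & forall i, B' i = lam i *: (v^t* *m B i *m v).
Proof.
case: n B B' T => [|n] B B' T genB canB canB' Tu lam1 B'E.
  by exists 1%:M => [|i]; [apply/unitarymxP | ]; apply/matrixP=> [[]].
have TT_herm : T *m T^t* \is hermsymmx.
  by apply/is_hermitianmxP; rewrite expr0 scale1r trmxCM trmxCK.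
have TT_fix : \sum_i B i *m (T *m T^t*) *m (B i)^t* = T *m T^t*.
  rewrite -[X in _ = X *m _](mulmx1 T) -canB' mulmx_sumr mulmx_suml; apply: eq_bigr => i _.
  have -> : B' i *m (B' i)^t* = (invmx T *m B i *m T) *m (invmx T *m B i *m T)^t*.
    by rewrite B'E trmxCZ -scalemxAl -scalemxAr scalerA -normCK lam1 expr1n scale1r.
  rewrite !trmxCM !mulmxA mulmxV // mul1mx -(mulmxA _ ((invmx T)^t*)) -trmxCM mulmxV // trmxC1.
  by rewrite mulmx1.
have /is_scalar_mxP[mu TT] := transfer_fixed_hermitian_scalar genB canB TT_herm TT_fix.
have mu_ge0 : 0 <= mu.
  have /matrixP/(_ 0 0) := TT; rewrite [RHS]mxE mulr1n => <-.
  rewrite -[T in T *m _]mulmx1 -diag_const_mx mulmx_trmxC_diagE sumr_ge0 // => k _.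
  by rewrite !mxE mul1r exprn_ge0.
have mu_neq0 : mu != 0.
  have : (mu%:M : 'M_n.+1) \in unitmx by rewrite -TT unitmx_mul Tu map_unitmx unitmx_tr.
  by apply: contraTneq => ->; rewrite unitmxE raddf0 det0 unitr0.
pose a := (sqrtC mu)^-1; have a_neq0 : a != 0 by rewrite invr_eq0 sqrtC_eq0.
have aTu : a *: T \is unitarymx.
  apply/unitarymxP; rewrite trmxCZ -scalemxAl -scalemxAr scalerA TT -normCK -normrX exprVn sqrtCK.
  by rewrite ger0_norm ?invr_ge0 // scale_scalar_mx mulVf.
exists (a *: T) => // i; rewrite B'E -invmx_unitary // invmxZ ?unitarymx_unit //.
congr (_ *: _).
by rewrite -!scalemxAl -scalemxAr scalerA mulVf // scale1r.
Qed.

End TransferFixedPoints.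

Lemma mxtrace_intertwined (R : comUnitRingType) m (V X X' : 'M[R]_m) z :
  V \in unitmx -> V *m X' = z *: (X *m V) -> \tr X' = z * \tr X.
Proof.
by move=> Vu VX'; rewrite -[X'](mulKmx Vu) VX' mxtrace_mulC -scalemxAl mulmxK // mxtraceZ.
Qed.

Section UnitaryRelation.
Variables (C : numClosedFieldType) (I : Type) (m : nat).
Implicit Types (A : I -> 'M[C]_m) (U V : 'M[C]_m) (z : C).

Definition unitarily_related A A' V z :=
  V \is unitarymx /\ forall i, V *m A' i = z *: (A i *m V).

Lemma unitarily_related_mul A A' V z U U' : U \is unitarymx -> U' \is unitarymx ->
    (forall i, comm_mx U (A i)) -> (forall i, comm_mx U' (A' i)) ->
  unitarily_related A A' V z -> unitarily_related A A' (U *m V *m U') z.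
Proof.
move=> Uu Uu' comU comU' [Vu VA']; split=> [|i]; first by rewrite !mul_unitarymx.
by rewrite -mulmxA comU' mulmxA -(mulmxA U) VA' -scalemxAr -scalemxAl !mulmxA comU.
Qed.

Lemma unitarily_related_div A A' V1 z1 V2 z2 : z1 != 0 ->
    unitarily_related A A' V1 z1 -> unitarily_related A A' V2 z2 ->
  unitarily_related A A (V2 *m V1^t*) (z2 / z1).
Proof.
move=> z1_neq0 [V1u V1A'] [V2u V2A']; split=> [|i]; first by rewrite mul_unitarymx ?trmxC_unitary.
have V1A : V1^t* *m A i = z1^-1 *: (A' i *m V1^t*).
  rewrite -[A i in LHS](mulmxtVK _ V1u) -[A i *m V1](scalerK z1_neq0) -V1A'.
  by rewrite -scalemxAl -scalemxAr !mulmxA mul_trmxC_unitarymx // mul1mx.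
by rewrite -mulmxA V1A -scalemxAr (mulmxA V2) V2A' -scalemxAl scalerA -mulmxA mulrC.
Qed.

Lemma unitarily_related_comm A A' V z U : unitarily_related A A' V z ->
  (forall i, comm_mx U (A i)) -> forall i, comm_mx (V^t* *m U *m V) (A' i).
Proof.
move=> [Vu VA'] comU i; apply: (can_inj (mulKmx (unitarymx_unit Vu))).
rewrite !mulmxA VA' (unitarymxP Vu) mul1mx -mulmxA VA' -scalemxAr -scalemxAl mulmxA comU.
by rewrite mulmxtVK // !scalemxAl.
Qed.

End UnitaryRelation.

Section TracelessReflections.
Variables (C : numClosedFieldType) (m : nat).

Definition traceless_reflection (u : 'M[C]_m) := [/\ u^t* = u, u *m u = 1%:M & \tr u = 0].

Variable u : 'M[C]_m.
Hypothesis refl_u : traceless_reflection u.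

Local Notation comb a c := (a *: 1%:M + c *: u).

Lemma reflection_combM a c a' c' :
  comb a c *m comb a' c' = comb (a * a' + c * c') (a * c' + c * a').
Proof.
case: refl_u => _ uu _; rewrite mulmxDl !mulmxDr -!scalemxAl -!scalemxAr !scalerA.
by rewrite !mul1mx mulmx1 uu !scalerDl [X in _ + X = _]addrC addrACA.
Qed.

Lemma reflection_comb_trmxC a c : (comb a c)^t* = comb a^* c^*.
Proof. by case: refl_u => u_herm _ _; rewrite trmxCD !trmxCZ trmxC1 u_herm. Qed.

Lemma mxtrace_reflection_comb a c : \tr (comb a c) = a * m%:R.
Proof. by case: refl_u => _ _ tru; rewrite mxtraceD !mxtraceZ mxtrace1 tru mulr0 addr0. Qed.

Hypothesis m_gt0 : (0 < m)%N.
Let m_neq0 : m%:R != 0 :> C. Proof. by rewrite pnatr_eq0 -lt0n. Qed.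

Lemma reflection_comb_eq1 a c : comb a c = 1%:M -> a = 1 /\ c = 0.
Proof.
move=> comb1; have a1 : a = 1.
  by apply: (mulIf m_neq0); rewrite -(mxtrace_reflection_comb a c) comb1 mxtrace1 mul1r.
split=> //; apply: (mulIf m_neq0); rewrite mul0r -mxtrace1.
have [_ uu tru] := refl_u.
have := congr1 (fun X => \tr (X *m u)) comb1.
by rewrite mulmxDl -!scalemxAl mul1mx uu mxtraceD !mxtraceZ tru mulr0 add0r.
Qed.

Lemma unitary_reflection_comb a c : comb a c \is unitarymx -> `|a + c| = 1 /\ `|a - c| = 1.
Proof.
move/unitarymxP; rewrite reflection_comb_trmxC reflection_combM.
case/reflection_comb_eq1 => norm1 cross0.
suff sqr_norm1 s : s ^+ 2 = 1 -> s^* = s -> `|a + s * c| = 1.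
  split; first by have := sqr_norm1 1; rewrite mul1r expr1n rmorph1; apply.
  by have := sqr_norm1 (-1); rewrite mulN1r sqrrN expr1n rmorphN rmorph1; apply.
move=> s2 sC; apply/eqP; rewrite -(@pexpr_eq1 _ _ 2) // normCK rmorphD rmorphM /= sC.
have -> : (a + s * c) * (a^* + s * c^*) =
  a * a^* + s ^+ 2 * (c * c^*) + s * (a * c^* + c * a^*) by ring.
by rewrite s2 mul1r norm1 cross0 mulr0 addr0.
Qed.

Lemma traceless_reflection_comb_sign X a c :
  traceless_reflection X -> X = comb a c -> exists eta : bool, X = (-1) ^+ eta *: u.
Proof.
move=> [_ XX trX] XE.
have a0 : a = 0 by apply: (mulIf m_neq0); rewrite mul0r -(mxtrace_reflection_comb a c) -XE.
rewrite a0 in XE; move: XX; rewrite {1 2}XE reflection_combM mul0r add0r XE scale0r add0r.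
case/reflection_comb_eq1 => c2 _.
have /eq_sqr_sign[eta ->] : c ^+ 2 = 1 ^+ 2 by rewrite expr1n expr2.
by exists eta; rewrite mulr1.
Qed.

End TracelessReflections.

Lemma traceless_reflection_conj (C : numClosedFieldType) m (V u : 'M[C]_m) :
  V \is unitarymx -> traceless_reflection u -> traceless_reflection (V^t* *m u *m V).
Proof.
move=> Vu [u_herm uu tru]; split.
- by rewrite !trmxCM trmxCK u_herm mulmxA.
- by rewrite !mulmxA mulmxtVK // -(mulmxA _ u u) uu mulmx1 mul_trmxC_unitarymx.
- by rewrite mxtrace_unitarymx_conj.
Qed.

Section Phases.
Variable R : realType.
Local Notation C := R[i].
Implicit Types (a b t : R) (z w : C).

Lemma norm_expi t : `|expi t| = 1.
Proof. by rewrite normc_def /= cos2Dsin2 sqrtr1. Qed.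

Lemma expi_neq0 t : expi t != 0.
Proof. by rewrite -normr_eq0 norm_expi oner_eq0. Qed.

Lemma expiD a b : expi (a + b) = expi a * expi b.
Proof. by apply/eqP; rewrite eq_complex /= cosD sinD [X in _ && (X == _)]addrC !eqxx. Qed.

Lemma cos_sin_surj a b : a ^+ 2 + b ^+ 2 = 1 -> exists t, cos t = a /\ sin t = b.
Proof.
move=> ab1; have a1 : -1 <= a <= 1.
  by rewrite -ler_norml -(expr_le1 (n := 2)) // real_normK ?num_real // -ab1 lerDl sqr_ge0.
have sin_acosE : sin (acos a) = `|b| by rewrite sin_acos // -ab1 addrAC subrr add0r sqrtr_sqr.
have [b0|b0] := leP 0 b; first by exists (acos a); rewrite acosK ?sin_acosE ?ger0_norm.
by exists (- acos a); rewrite cosN sinN acosK // sin_acosE ltr0_norm // opprK.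
Qed.

Lemma expi_surj z : `|z| = 1 -> exists t, z = expi t.
Proof.
move=> /(congr1 (fun x => x ^+ 2)); rewrite -add_Re2_Im2 expr1n => /(@complexI R).
by case: z => x y /= /cos_sin_surj[t [<- <-]]; exists t.
Qed.

Lemma expi_addN t : expi t + expi (- t) = 2 * (cos t)%:C%C.
Proof.
apply/eqP; rewrite mulr_natl mulr2n eq_complex /= cosN sinN.
by rewrite subrr addr0 !eqxx.
Qed.

Lemma expi_subN t : expi t - expi (- t) = 2 * ((sin t)*i)%C.
Proof.
apply/eqP; rewrite mulr_natl mulr2n eq_complex /= cosN sinN.
by rewrite opprK subrr addr0 !eqxx.
Qed.

Lemma unimodular_addB_polar z w : `|z + w| = 1 -> `|z - w| = 1 -> exists psi theta,
  z = expi psi * (cos theta)%:C%C /\ w = expi psi * ((sin theta)*i)%C.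
Proof.
move=> /expi_surj[s zwD] /expi_surj[t zwB]; pose psi := (s + t) / 2; pose theta := (s - t) / 2.
have two_neq0 : 2 != 0 :> C by rewrite pnatr_eq0.
have sE : s = psi + theta by rewrite /psi /theta; field.
have tE : t = psi - theta by rewrite /psi /theta; field.
exists psi, theta; split; apply: (mulfI two_neq0); rewrite mulrCA.
- by rewrite -expi_addN mulrDr -!expiD -sE -tE -zwD -zwB; ring.
- by rewrite -expi_subN mulrBr -!expiD -sE -tE -zwD -zwB; ring.
Qed.

Lemma expiu0 m (u : 'M[C]_m) : expiu 0 u = 1%:M.
Proof. by rewrite /expiu cos0 sin0 scale1r scale0r addr0. Qed.

Variables (m : nat) (u : 'M[C]_m).
Hypothesis refl_u : traceless_reflection u.

Lemma expiu_unitary theta : expiu theta u \is unitarymx.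
Proof.
apply/unitarymxP; rewrite /expiu reflection_comb_trmxC // reflection_combM //.
have -> : (cos theta)%:C%C * ((cos theta)%:C%C)^* + ((sin theta)*i)%C * ((sin theta)*i)%C^* = 1.
  apply/eqP; rewrite eq_complex /= !(mulr0, mul0r, oppr0, addr0, subr0, sub0r, mulrN, opprK).
  by rewrite -!expr2 cos2Dsin2 !eqxx.
have -> : (cos theta)%:C%C * ((sin theta)*i)%C^* + ((sin theta)*i)%C * ((cos theta)%:C%C)^* = 0.
  apply/eqP; rewrite eq_complex /= !(mulr0, mul0r, oppr0, addr0, subr0, sub0r, mulrN).
  by rewrite add0r [cos _ * _]mulrC addNr !eqxx.
by rewrite scale1r scale0r addr0.
Qed.

Lemma unitary_reflection_comb_expiu z w : (0 < m)%N -> z *: 1%:M + w *: u \is unitarymx ->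
  exists psi theta, z *: 1%:M + w *: u = expi psi *: expiu theta u.
Proof.
move=> m_gt0 /(unitary_reflection_comb refl_u m_gt0)[normD normB].
have [psi [theta [-> ->]]] := unimodular_addB_polar normD normB.
by exists psi, theta; rewrite /expiu scalerDr !scalerA.
Qed.

End Phases.

Lemma sum_mxtens_index (V : nmodType) m p (F : 'I_(m * p) -> V) :
  \sum_k F k = \sum_i \sum_j F (mxtens_index (i, j)).
Proof.
rewrite pair_big (reindex (@mxtens_index m p)) /=; first by apply: eq_bigr => [[]].
by exists (@mxtens_unindex m p) => k _; [apply: mxtens_indexK | apply: mxtens_unindexK].
Qed.

Section TensorProducts.
Variable R : comNzRingType.

Lemma tensmx_is_linear m n p q (S : 'M[R]_(m, n)) :
  linear (tensmx S : 'M[R]_(p, q) -> _).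
Proof. by move=> a X Y; apply/matrixP=> i j; rewrite !mxE mulrDr mulrCA. Qed.

HB.instance Definition _ m n p q (S : 'M[R]_(m, n)) :=
  GRing.isLinear.Build R 'M[R]_(p, q) 'M[R]_(m * p, n * q) _ (tensmx S) (tensmx_is_linear S).

Lemma tensmxDl m n p q (S S' : 'M[R]_(m, n)) (X : 'M[R]_(p, q)) :
  (S + S') *t X = S *t X + S' *t X.
Proof. by apply/matrixP=> i j; rewrite !mxE mulrDl. Qed.

Lemma tensmxZl m n p q a (S : 'M[R]_(m, n)) (X : 'M[R]_(p, q)) :
  (a *: S) *t X = a *: (S *t X).
Proof. by apply/matrixP=> i j; rewrite !mxE mulrA. Qed.

Lemma tensmx11 m p : (1%:M : 'M[R]_m) *t (1%:M : 'M[R]_p) = 1%:M.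
Proof.
apply/matrixP=> i j; case: (mxtens_indexP i) => i1 i2; case: (mxtens_indexP j) => j1 j2.
by rewrite tensmxE !mxE (can_eq (@mxtens_indexK _ _)) xpair_eqE -mulnb natrM.
Qed.

Lemma mxtrace_tens m p (S : 'M[R]_m) (X : 'M[R]_p) :
  \tr (S *t X) = \tr S * \tr X.
Proof.
rewrite /mxtrace sum_mxtens_index mulr_suml; apply: eq_bigr => i _.
by rewrite mulr_sumr; apply: eq_bigr => j _; rewrite tensmxE.
Qed.

Definition tens_block m n p q (X : 'M[R]_(m * p, n * q)) i j : 'M_(p, q) :=
  \matrix_(k, l) X (mxtens_index (i, k)) (mxtens_index (j, l)).

Lemma tens_blockMr m p (X : 'M[R]_(m * p)) (M : 'M_p) i j :
  tens_block (X *m (1%:M *t M)) i j = tens_block X i j *m M.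
Proof.
apply/matrixP=> k l; rewrite !mxE sum_mxtens_index (bigD1 j) //= [X in _ + X]big1 ?addr0.
  by apply: eq_bigr => r _; rewrite tensmxE !mxE eqxx mul1r.
by move=> s sj; rewrite big1 // => r _; rewrite tensmxE mxE (negbTE sj) mul0r mulr0.
Qed.

Lemma tens_blockMl m p (X : 'M[R]_(m * p)) (M : 'M_p) i j :
  tens_block ((1%:M *t M) *m X) i j = M *m tens_block X i j.
Proof.
apply/matrixP=> k l; rewrite !mxE sum_mxtens_index (bigD1 i) //= [X in _ + X]big1 ?addr0.
  by apply: eq_bigr => r _; rewrite tensmxE !mxE eqxx mul1r.
by move=> s si; rewrite big1 // => r _; rewrite tensmxE mxE eq_sym (negbTE si) !mul0r.
Qed.

Lemma cent_tens1mx m p (X : 'M[R]_(m * p.+1)) :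
  (forall M : 'M_p.+1, comm_mx X (1%:M *t M)) -> exists S, X = S *t 1%:M.
Proof.
move=> comX; exists (\matrix_(i, j) tens_block X i j 0 0); apply/matrixP=> i j.
case: (mxtens_indexP i) => i1 i2; case: (mxtens_indexP j) => j1 j2.
have /is_scalar_mxP[a blockE] : is_scalar_mx (tens_block X i1 j1).
  by apply: cent_mx_is_scalar => M; rewrite /comm_mx -tens_blockMr comX tens_blockMl.
have /matrixP/(_ i2 j2) := blockE; rewrite [LHS]mxE tensmxE => ->.
by rewrite [X in _ = X * _]mxE blockE !mxE eqxx mulr_natr.
Qed.

End TensorProducts.

Lemma tensmx_injr (R : idomainType) m n p q (S : 'M[R]_(m, n)) :
  S != 0 -> injective (tensmx S : 'M[R]_(p, q) -> _).
Proof.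
move=> /matrix0Pn[i [j Sij]] X Y /matrixP SXY; apply/matrixP=> k l; apply: (mulfI Sij).
by have := SXY (mxtens_index (i, k)) (mxtens_index (j, l)); rewrite !tensmxE.
Qed.

Lemma tensmx_injl (R : idomainType) m n p q (X : 'M[R]_(p, q)) :
  X != 0 -> injective ((tensmx (R := R))^~ X : 'M[R]_(m, n) -> _).
Proof.
move=> /matrix0Pn[k [l Xkl]] S S' /matrixP SXY; apply/matrixP=> i j; apply: (mulIf Xkl).
by have := SXY (mxtens_index (i, k)) (mxtens_index (j, l)); rewrite !tensmxE.
Qed.

Lemma trmxC_tens (C : numClosedFieldType) m n p q (S : 'M[C]_(m, n)) (X : 'M[C]_(p, q)) :
  (S *t X)^t* = S^t* *t X^t*.
Proof. by rewrite trmx_tens map_mxT. Qed.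

Lemma tens_unitarymx (C : numClosedFieldType) m n p q (U : 'M[C]_(m, n)) (V : 'M[C]_(p, q)) :
  U \is unitarymx -> V \is unitarymx -> U *t V \is unitarymx.
Proof.
move=> /unitarymxP UU /unitarymxP VV; apply/unitarymxP.
by rewrite trmxC_tens tensmx_mul UU VV tensmx11.
Qed.

Lemma matrix2P T (S S' : 'M[T]_2) : S 0 0 = S' 0 0 -> S 0 1 = S' 0 1 -> S 1 0 = S' 1 0 ->
  S 1 1 = S' 1 1 -> S = S'.
Proof.
move=> E00 E01 E10 E11; apply/matrixP.
have I2 (i : 'I_2) : i = 0 \/ i = 1.
  by case: i => [[|[|]]] // ?; [left | right]; apply/val_inj.
by move=> i j; case: (I2 i) => ->; case: (I2 j) => ->.
Qed.

Lemma mulmx2E (R : pzSemiRingType) (S S' : 'M[R]_2) i j :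
  (S *m S') i j = S i 0 * S' 0 j + S i 1 * S' 1 j.
Proof. by rewrite mxE big_ord_recl big_ord1; congr (_ + S i _ * S' _ j); apply/val_inj. Qed.

Section Pauli.
Variable R : realType.
Local Notation C := R[i].

Definition pauli_x (b : bool) : 'M[C]_2 := if b then sigma_x R else 1%:M.
Definition pauli_z (b : bool) : 'M[C]_2 := if b then sigma_z R else 1%:M.

Lemma pauli_xM b b' : pauli_x b *m pauli_x b' = pauli_x (b (+) b').
Proof.
case: b b' => [] []; rewrite /pauli_x /= ?mul1mx ?mulmx1 //.
by apply: matrix2P; rewrite mulmx2E !mxE /= !(mulr0, mulr1, addr0, add0r).
Qed.

Lemma trmxC_pauli_x b : (pauli_x b)^t* = pauli_x b.
Proof.
case: b; rewrite /pauli_x ?trmxC1 //.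
by apply: matrix2P; rewrite !mxE /= ?rmorph0 ?rmorph1.
Qed.

Lemma mxtrace_pauli_x b : \tr (pauli_x b) = if b then 0 else 2.
Proof. by case: b; rewrite /pauli_x ?mxtrace1 // /mxtrace big1 // => i _; rewrite mxE eqxx. Qed.

Lemma pauli_x_neq0 b : pauli_x b != 0.
Proof.
by apply/matrix0Pn; exists 0, (if b then 1 else 0); case: b; rewrite /pauli_x mxE oner_neq0.
Qed.

Lemma cent_pauli_x (S : 'M[C]_2) : comm_mx S (pauli_x true) ->
  exists a c, S = a *: 1%:M + c *: pauli_x true.
Proof.
move=> /matrixP comS; exists (S 0 0), (S 0 1).
have := comS 0 0; have := comS 0 1; rewrite !mulmx2E !mxE /=.
rewrite !(mulr0, mulr1, mul0r, mul1r, addr0, add0r) => S00 S01.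
by apply: matrix2P; rewrite !mxE /= ?(mulr0, mulr1, addr0, add0r).
Qed.

Lemma trmxC_pauli_z b : (pauli_z b)^t* = pauli_z b.
Proof.
case: b; rewrite /pauli_z ?trmxC1 //.
by apply: matrix2P; rewrite !mxE /= ?rmorphN ?rmorph0 ?rmorph1.
Qed.

Lemma pauli_z_sqr b : pauli_z b *m pauli_z b = 1%:M.
Proof.
case: b; rewrite /pauli_z ?mulmx1 //.
by apply: matrix2P; rewrite mulmx2E !mxE /= !(mulr0, mulr1, mul0r, addr0, add0r, mulrNN).
Qed.

Lemma pauli_z_unitary b : pauli_z b \is unitarymx.
Proof. by apply/unitarymxP; rewrite trmxC_pauli_z pauli_z_sqr. Qed.

Lemma pauli_zxz k b : pauli_z k *m pauli_x b *m pauli_z k = (-1) ^+ (k && b) *: pauli_x b.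
Proof.
case: k b => [] []; rewrite /pauli_x ?expr0 ?expr1 ?scale1r ?mulmx1 ?pauli_z_sqr //.
  apply: matrix2P; rewrite !mulmx2E !mxE /=;
    by rewrite !(mulr0, mulr1, mul0r, addr0, add0r, mulrN1, mulN1r, oppr0).
by rewrite mul1mx.
Qed.

End Pauli.

Section DefinitionBridges.
Variables (R : realType) (N : nat).
Local Notation C := R[i].

Lemma adjE m n (A : 'M[C]_(m, n)) : adj A = A^t*.
Proof. by []. Qed.

Lemma unitaryP m (U : 'M[C]_m) : unitary U <-> U \is unitarymx.
Proof.
split=> [[UU _]|Uu]; first exact/unitarymxP.
by split; rewrite adjE; [apply/unitarymxP | apply: mul_trmxC_unitarymx].
Qed.

Lemma mxword_codom m (A : 'I_N -> 'M[C]_m) L (s : {ffun 'I_L -> 'I_N}) :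
  mxword A s = word A (codom s).
Proof. by rewrite /mxword /word codomE big_map enumT [index_enum _]unlock. Qed.

Lemma wpar_codom (par : 'I_N -> bool) L (s : {ffun 'I_L -> 'I_N}) :
  wpar par s = parity par (codom s).
Proof.
rewrite /wpar /parity codomE big_map enumT [index_enum _]unlock.
rewrite (big_morph odd oddD (erefl : odd 0 = false)).
by apply: eq_bigr => k _; rewrite oddb.
Qed.

Lemma size_codom_ord L (s : {ffun 'I_L -> 'I_N}) : size (codom s) = L.
Proof. by rewrite size_codom card_ord. Qed.

Lemma codom_ffun_surj (t : seq 'I_N) : exists s : {ffun 'I_(size t) -> 'I_N}, codom s = t.
Proof.
exists [ffun k => tnth (in_tuple t) k].
by rewrite codomE; under eq_map do rewrite ffunE; rewrite map_tnth_enum.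
Qed.

Lemma spans_parity_words_span (par : 'I_N -> bool) n (B : 'I_N -> 'M[C]_n) l b :
  spans_parity par B l b -> words_span par B b l.
Proof.
move=> spanB X; have [c ->] := spanB X; rewrite big_mkcond; apply: same_comb_sum => s.
case: eqP => [s_par|_]; last exact: same_comb0.
rewrite mxword_codom -[_ *: _]addr0; apply: same_comb_cons (same_comb0 _ _ _ _ _).
  exact: size_codom_ord.
by rewrite -wpar_codom.
Qed.

End DefinitionBridges.

(* Locked, lest unification unfold the tensor product. *)
HB.lock Definition wallmx (R : realType) n (W : 'M[R[i]]_(2 * n)) (b : bool) (X : 'M[R[i]]_n) :
  'M[R[i]]_(2 * n) := W *m (pauli_x R b *t X) *m W^t*.

Section WallMatrices.
Variables (R : realType) (n : nat).
Local Notation C := R[i].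

Lemma wallmxE (W : 'M[C]_(2 * n)) b X : wallmx W b X = W *m (pauli_x R b *t X) *m W^t*.
Proof. by rewrite unlock. Qed.

Lemma wallmx_is_linear (W : 'M[C]_(2 * n)) b : linear (wallmx W b).
Proof. by move=> a X Y; rewrite !wallmxE linearP mulmxDr mulmxDl -scalemxAr -scalemxAl. Qed.

HB.instance Definition _ (W : 'M[C]_(2 * n)) b :=
  GRing.isLinear.Build C 'M[C]_n 'M[C]_(2 * n) _ (wallmx W b) (wallmx_is_linear W b).

Lemma trmxC_wallmx (W : 'M[C]_(2 * n)) b X : (wallmx W b X)^t* = wallmx W b (X^t*).
Proof. by rewrite !wallmxE !trmxCM trmxCK trmxC_tens trmxC_pauli_x mulmxA. Qed.

Variable W : 'M[C]_(2 * n).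
Hypothesis Wu : W \is unitarymx.

Lemma wallmxM b b' X X' : wallmx W b X *m wallmx W b' X' = wallmx W (b (+) b') (X *m X').
Proof. by rewrite !wallmxE !mulmxA (mulmxKtV _ Wu) // -(mulmxA W) tensmx_mul pauli_xM. Qed.

Lemma wallmx1 : wallmx W false 1%:M = 1%:M.
Proof. by rewrite wallmxE tensmx11 mulmx1 (unitarymxP _). Qed.

Lemma mxtrace_wallmx b X : \tr (wallmx W b X) = if b then 0 else 2 * \tr X.
Proof.
rewrite wallmxE mxtrace_mulC mulmxA mul_trmxC_unitarymx // mul1mx mxtrace_tens mxtrace_pauli_x.
by case: b; rewrite ?mul0r.
Qed.

Lemma wallmxK b X : W^t* *m wallmx W b X *m W = pauli_x R b *t X.
Proof. by rewrite wallmxE unitarymx_conjK. Qed.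

Lemma wallmx_inj b : injective (wallmx W b).
Proof.
move=> X Y eqXY; apply: (tensmx_injr (pauli_x_neq0 R b)).
by rewrite -!wallmxK eqXY.
Qed.

Lemma wallmx_traceless_reflection : traceless_reflection (wallmx W true 1%:M).
Proof.
split; first by rewrite trmxC_wallmx trmxC1.
  by rewrite wallmxM mulmx1 wallmx1.
by rewrite mxtrace_wallmx.
Qed.

Lemma conj_wallmx (W' : 'M[C]_(2 * n)) k v b X (V := W *m (pauli_z R k *t v) *m W'^t*) :
  V^t* *m wallmx W b X *m V = (-1) ^+ (k && b) *: wallmx W' b (v^t* *m X *m v).
Proof.
have tensE : (pauli_z R k *t v)^t* *m (pauli_x R b *t X) *m (pauli_z R k *t v) =
    (-1) ^+ (k && b) *: (pauli_x R b *t (v^t* *m X *m v)).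
  by rewrite trmxC_tens trmxC_pauli_z 2!tensmx_mul pauli_zxz tensmxZl.
by rewrite congruence_trmxCM [wallmx W' _ _]wallmxE scalemxAl scalemxAr -tensE -(wallmxK b X).
Qed.

End WallMatrices.

Lemma cent_wallmx (R : realType) n (W X : 'M[R[i]]_(2 * n.+1)) : W \is unitarymx ->
    (forall b M, comm_mx X (wallmx W b M)) ->
  exists a c, X = a *: 1%:M + c *: wallmx W true 1%:M.
Proof.
move=> Wu comX; pose Y := W^t* *m X *m W.
have XE : X = W *m Y *m W^t* by rewrite /Y !mulmxA (unitarymxP _) // mul1mx mulmxtVK.
have comY b M : comm_mx Y (pauli_x R b *t M).
  rewrite -(wallmxK Wu) /Y /comm_mx.
  have mulY (P Q : 'M_(2 * n.+1)) : W^t* *m P *m W *m (W^t* *m Q *m W) = W^t* *m (P *m Q) *m W.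
    by rewrite !mulmxA mulmxtVK.
  by rewrite !mulY comX.
have [S YE] := cent_tens1mx (comY false).
have [a [c SE]] : exists a c, S = a *: 1%:M + c *: pauli_x R true.
  apply: cent_pauli_x; apply: (@tensmx_injl _ _ _ n.+1 n.+1 1%:M).
    by apply/matrix0Pn; exists 0, 0; rewrite mxE oner_neq0.
  by have := comY true 1%:M; rewrite /comm_mx YE !tensmx_mul mulmx1.
exists a, c; rewrite XE YE SE wallmxE tensmxDl !tensmxZl tensmx11 mulmxDr mulmxDl.
by rewrite -!scalemxAr -!scalemxAl mulmx1 (unitarymxP Wu).
Qed.

Lemma relatedP (R : realType) N m (A At : 'I_N -> 'M[R[i]]_m) V beta :
  related A At V beta <-> unitarily_related A At V (expi beta).
Proof.
split=> [[/unitaryP Vu AtE]|[Vu VAt]]; split=> [|i].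
- exact: Vu.
- by rewrite AtE -scalemxAr !mulmxA (unitarymxP Vu) mul1mx.
- exact/unitaryP.
- by rewrite -mulmxA scalemxAr -VAt mulmxA (mul_trmxC_unitarymx Vu) mul1mx.
Qed.

Definition boundary_mx (R : realType) m (pbc : bool) (u : 'M[R[i]]_m) : 'M[R[i]]_m :=
  if pbc then u else 1%:M.

Section WallDecomposition.
Variables (R : realType) (N : nat) (par : 'I_N -> bool).
Local Notation C := R[i].

Record wall_decomposition n (A : 'I_N -> 'M[C]_(2 * n)) (u W : 'M[C]_(2 * n))
    (B : 'I_N -> 'M[C]_n) (l : nat) : Prop := WallDecomposition {
  wall_unitary : W \is unitarymx;
  wall_letter : forall i, A i = wallmx W (par i) (B i);
  wall_reflection : u = wallmx W true 1%:M;
  wall_canonical : \sum_i B i *m (B i)^t* = 1%:M;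
  wall_span : forall b L, (l <= L)%N -> words_span par B b L
}.

Lemma wall_minus_decomposition n (A : 'I_N -> 'M[C]_(2 * n)) u :
    wall_minus par A u -> fMPS_canonical A ->
  exists W B l, wall_decomposition A u W B l.
Proof.
case=> W [B [/unitaryP Wu AE [l [span_even span_odd]] uE]] canA.
have {}AE i : A i = wallmx W (par i) (B i) by rewrite wallmxE; apply: AE.
have {}uE : u = wallmx W true 1%:M by rewrite wallmxE.
have canB : \sum_i B i *m (B i)^t* = 1%:M.
  apply: (wallmx_inj Wu (b := false)); rewrite linear_sum wallmx1 // -canA.
  apply: eq_bigr => i _.
  by rewrite AE adjE trmxC_wallmx wallmxM // addbb.
exists W, B, l; split=> // b L lL; apply: (words_span_leq canB lL) => {}b.
by case: b; apply: spans_parity_words_span.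
Qed.

Variables (n : nat) (A : 'I_N -> 'M[C]_(2 * n.+1)) (u W : 'M[C]_(2 * n.+1)).
Variables (B : 'I_N -> 'M[C]_n.+1) (l : nat).
Hypothesis wallA : wall_decomposition A u W B l.
Let Wu : W \is unitarymx := wall_unitary wallA.

Lemma wall_word t : word A t = wallmx W (parity par t) (word B t).
Proof.
rewrite /word /parity; elim: t => [|i t IH]; first by rewrite !big_nil wallmx1.
by rewrite !big_cons IH (wall_letter wallA) wallmxM.
Qed.

Lemma mxtrace_wall_word b t : \tr (boundary_mx b u *m word A t) =
  if parity par t == b then 2 * \tr (word B t) else 0.
Proof.
have -> : boundary_mx b u = wallmx W b 1%:M.
  by case: b; rewrite /boundary_mx ?wallmx1 // (wall_reflection wallA).
rewrite wall_word wallmxM // mul1mx mxtrace_wallmx //.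
by case: b (parity par t) => [] [].
Qed.

Lemma wall_traceless_reflection : traceless_reflection u.
Proof. by rewrite (wall_reflection wallA); apply: wallmx_traceless_reflection. Qed.

Lemma wall_comm i : comm_mx u (A i).
Proof.
rewrite /comm_mx (wall_reflection wallA) (wall_letter wallA) !wallmxM //.
by rewrite mul1mx mulmx1 addbC.
Qed.

Lemma wall_expiu_comm theta i : comm_mx (expiu theta u) (A i).
Proof.
by rewrite /comm_mx /expiu mulmxDl mulmxDr -!scalemxAl -!scalemxAr mul1mx mulmx1 wall_comm.
Qed.

Section Intertwiner.
Variables (X : 'M[C]_(2 * n.+1)) (z : C).
Hypothesis XA : forall i, X *m A i = z *: (A i *m X).

Lemma intertwiner_wallmx L b M : (l <= L)%N ->
  X *m wallmx W b M = z ^+ L *: (wallmx W b M *m X).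
Proof.
move=> lL; move: M; apply: (words_span_ind (wall_span wallA b lL)) => [|a t M <- <- IH].
  by rewrite linear0 mulmx0 mul0mx scaler0.
rewrite linearP /= -wall_word mulmxDr mulmxDl scalerDr IH -scalemxAr -scalemxAl.
by rewrite (intertwiner_word _ XA) !scalerA mulrC.
Qed.

(* Words of both lengths [l] and [l + 1] combine to the identity. *)
Lemma intertwiner_phase : X != 0 -> z = 1.
Proof.
move=> X0; have zX1 L : (l <= L)%N -> z ^+ L = 1.
  move=> lL; have := intertwiner_wallmx false 1%:M lL.
  rewrite wallmx1 // mulmx1 mul1mx => /esym/eqP.
  by rewrite -subr_eq0 -[X in _ - X]scale1r -scalerBl scaler_eq0 (negbTE X0) orbF subr_eq0 => /eqP.
by have := zX1 _ (leqnSn l); rewrite exprS zX1 // mulr1.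
Qed.

End Intertwiner.

Lemma wall_commutant X : (forall i, comm_mx X (A i)) -> exists a c, X = a *: 1%:M + c *: u.
Proof.
move=> comX; rewrite (wall_reflection wallA); apply: cent_wallmx => // b M.
have XA i : X *m A i = 1 *: (A i *m X) by rewrite scale1r comX.
by rewrite /comm_mx (intertwiner_wallmx XA b M (leqnn l)) expr1n scale1r.
Qed.

Lemma wall_self_related X z : unitarily_related A A X z ->
  z = 1 /\ exists psi theta, X = expi psi *: expiu theta u.
Proof.
move=> [Xu XA]; have X0 : X != 0.
  apply: contraTneq (unitarymx_unit Xu) => ->.
  by rewrite unitmxE det0 unitr0.
have z1 := intertwiner_phase XA X0; split=> //.
have [|a [c XE]] := @wall_commutant X; first by move=> i; rewrite /comm_mx XA z1 scale1r.
rewrite XE in Xu *.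
by apply: (unitary_reflection_comb_expiu wall_traceless_reflection).
Qed.

Lemma related_unique At V1 b1 V2 b2 : related A At V1 b1 -> related A At V2 b2 ->
  expi b1 = expi b2 /\ exists psi theta, V2 = expi psi *: (expiu theta u *m V1).
Proof.
move=> /relatedP relV1 /relatedP relV2.
have [phase1 [psi [theta XE]]] :=
  wall_self_related (unitarily_related_div (expi_neq0 b1) relV1 relV2).
split; first by rewrite -[LHS]mul1r -phase1 divfK ?expi_neq0.
by exists psi, theta; rewrite scalemxAl -XE; rewrite (mulmxKtV _ relV1.1).
Qed.

End WallDecomposition.

Definition gauge_equiv_bc (R : realType) N m (pbc : bool) (A At : 'I_N -> 'M[R[i]]_m)
    (u ut : 'M[R[i]]_m) : Prop :=
  forall L, exists alpha : R, forall s : {ffun 'I_L -> 'I_N},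
    \tr (boundary_mx pbc u *m mxword A s) = expi alpha * \tr (boundary_mx pbc ut *m mxword At s).

Lemma gauge_equiv_bcF (R : realType) N m (A At : 'I_N -> 'M[R[i]]_m) u ut :
  gauge_equiv A At <-> gauge_equiv_bc false A At u ut.
Proof.
by split=> gauge L; have [alpha trE] := gauge L; exists alpha => s; have := trE s;
  rewrite !mul1mx.
Qed.

Section WallPair.
Variables (R : realType) (N : nat) (par : 'I_N -> bool) (n : nat).
Local Notation C := R[i].
Variables (A At : 'I_N -> 'M[C]_(2 * n.+1)) (u ut W Wt : 'M[C]_(2 * n.+1)).
Variables (B Bt : 'I_N -> 'M[C]_n.+1) (l lt : nat).
Hypothesis wallA : wall_decomposition par A u W B l.
Hypothesis wallAt : wall_decomposition par At ut Wt Bt lt.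

Lemma gauge_equiv_bc_mxtrace b : gauge_equiv_bc b A At u ut ->
  exists alpha : nat -> R, forall t, parity par t = b ->
    \tr (word B t) = expi (alpha (size t)) * \tr (word Bt t).
Proof.
move=> /choice[alpha trE]; exists alpha => t t_par.
have two_neq0 : 2 != 0 :> C by rewrite pnatr_eq0.
have [s sE] := codom_ffun_surj t; have := trE _ s.
rewrite !mxword_codom sE (mxtrace_wall_word wallA) (mxtrace_wall_word wallAt) t_par eqxx.
by rewrite mulrCA => /(mulfI two_neq0).
Qed.

Lemma block_traces_unitarily_similar b (alpha : nat -> R) :
    (forall t, parity par t = b -> \tr (word B t) = expi (alpha (size t)) * \tr (word Bt t)) ->
  exists v (k : bool) beta, v \is unitarymx /\
    forall i, Bt i = (expi beta * (-1) ^+ (k && par i)) *: (v^t* *m B i *m v).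
Proof.
move=> trE; have spanB b' L : (maxn l lt <= L)%N -> words_span par B b' L.
  by rewrite geq_max => /andP[lL _]; apply: wall_span wallA _ _ lL.
have spanBt b' L : (maxn l lt <= L)%N -> words_span par Bt b' L.
  by rewrite geq_max => /andP[_ lL]; apply: wall_span wallAt _ _ lL.
have [T [lam [Tu lam_norm lam_sqr BtE]]] :=
  proportional_traces_similar spanB spanBt (fun L => norm_expi (alpha L)) trE.
have [v vu BtE'] : exists2 v, v \is unitarymx &
    forall i, Bt i = lam (par i) *: (v^t* *m B i *m v).
  apply: similar_canonical_unitary Tu _ BtE => //.
  - exact: words_span_generates (spanB false _ (leqnn _)).
  - exact: wall_canonical wallA.
  - exact: wall_canonical wallAt.
have [k lam_true] := eq_sqr_sign lam_sqr; have [beta lamE] := expi_surj (lam_norm false).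
exists v, k, beta; split=> // i; rewrite BtE'; congr (_ *: _).
by case: (par i); rewrite ?andbT ?andbF ?mulr1 ?lam_true lamE // mulrC.
Qed.

Lemma gauge_equiv_bc_related b : gauge_equiv_bc b A At u ut ->
  exists V beta, related A At V beta.
Proof.
move=> /gauge_equiv_bc_mxtrace[alpha /block_traces_unitarily_similar[v [k [beta [vu BtE]]]]].
have [Wu Wtu] := (wall_unitary wallA, wall_unitary wallAt).
exists (W *m (pauli_z R k *t v) *m Wt^t*), beta; split=> [|i].
  apply/unitaryP; apply: mul_unitarymx; last by rewrite trmxC_unitary.
  exact: mul_unitarymx Wu (tens_unitarymx (pauli_z_unitary R k) vu).
rewrite adjE (wall_letter wallA) conj_wallmx // (wall_letter wallAt) BtE.
by rewrite linearZ scalerA.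
Qed.

Lemma related_wall V beta : related A At V beta ->
  exists eta : bool, ut = (-1) ^+ eta *: (V^t* *m u *m V).
Proof.
move=> /relatedP relV; pose X := V^t* *m u *m V.
have reflX : traceless_reflection X.
  by apply: traceless_reflection_conj relV.1 (wall_traceless_reflection wallA).
have [a [c XE]] := wall_commutant wallAt (unitarily_related_comm relV (wall_comm wallA)).
have dim_gt0 : (0 < 2 * n.+1)%N by [].
have [eta XEta] :=
  traceless_reflection_comb_sign (wall_traceless_reflection wallAt) dim_gt0 reflX XE.
by exists eta; rewrite -/X XEta scalerA -signr_addb addbb scale1r.
Qed.

Lemma related_gauge_equiv_bc b V beta : related A At V beta -> gauge_equiv_bc b A At u ut.
Proof.
move=> rel L; have [eta utE] := related_wall rel; move/relatedP: rel => [Vu VAt].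
pose z := (-1) ^+ (b && eta) * expi beta ^+ L.
have [alpha zE] : exists alpha, z^-1 = expi alpha.
  by apply: expi_surj; rewrite normfV normrM !normrX norm_expi normrN1 !expr1n mulr1 invr1.
exists alpha => s; rewrite -zE.
have Vut : V *m boundary_mx b ut = (-1) ^+ (b && eta) *: (boundary_mx b u *m V).
  case: b @z zE; last by rewrite mulmx1 mul1mx scale1r.
  by rewrite andTb utE -(scalemxAr _ V) (mulmx_unitarymx_conj _ Vu).
have -> : \tr (boundary_mx b ut *m mxword At s) =
    z * \tr (boundary_mx b u *m mxword A s).
  apply: (mxtrace_intertwined (unitarymx_unit Vu)).
  rewrite mulmxA Vut -scalemxAl -mulmxA !mxword_codom (intertwiner_word _ VAt) size_codom_ord.
  by rewrite -scalemxAr scalerA -/z mulmxA.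
by rewrite mulKf // mulf_neq0 ?signr_eq0 ?expf_neq0 ?expi_neq0.
Qed.

Lemma related_expiu V beta psi theta phi : related A At V beta ->
  related A At (expi psi *: (expiu theta u *m V *m expiu phi ut)) beta.
Proof.
move=> /relatedP relV; apply/relatedP; rewrite !scalemxAl.
apply: unitarily_related_mul relV => [||i|]; last exact: wall_expiu_comm wallAt phi.
- apply: unitarymxZ (norm_expi psi) _.
  exact: expiu_unitary (wall_traceless_reflection wallA) theta.
- exact: expiu_unitary (wall_traceless_reflection wallAt) phi.
by rewrite /comm_mx -scalemxAl -scalemxAr (wall_expiu_comm wallA).
Qed.

End WallPair.

Theorem mainTheorem2 (R : realType) (N n : nat) (par : 'I_N -> bool)
    (A At : 'I_N -> 'M[R[i]]_(2 * n)) (u ut : 'M[R[i]]_(2 * n)) :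
  (1 <= N)%N -> (1 <= n)%N ->
  is_fMPS par A -> is_fMPS par At ->
  wall_minus par A u -> wall_minus par At ut ->
  fMPS_canonical A -> fMPS_canonical At ->
  (* existence, for ~ and for ~_PBC *)
  (gauge_equiv A At <-> exists V beta, related A At V beta) /\
  (gauge_equiv_PBC A At u ut <-> exists V beta, related A At V beta) /\
  (* uniqueness of the phase and of V up to e^{i psi} e^{i theta u} V e^{i phi ut} *)
  (forall V1 b1 V2 b2, related A At V1 b1 -> related A At V2 b2 ->
     expi b1 = expi b2 /\
     exists psi theta phi : R,
       V2 = expi psi *: (expiu theta u *m V1 *m expiu phi ut)) /\
  (forall V1 b1, related A At V1 b1 -> forall psi theta phi : R,
     related A At (expi psi *: (expiu theta u *m V1 *m expiu phi ut)) b1) /\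
  (* Wall matrices are related by V *)
  (forall V b, related A At V b ->
     exists eta : bool, ut = (-1) ^+ eta *: (adj V *m u *m V)).
Proof.
case: n A At u ut => [|n] A At u ut _ // _ _ _ minusA minusAt canA canAt.
have [W [B [l wallA]]] := wall_minus_decomposition minusA canA.
have [Wt [Bt [lt wallAt]]] := wall_minus_decomposition minusAt canAt.
have equiv b : gauge_equiv_bc b A At u ut <-> exists V beta, related A At V beta.
  split=> [gauge|]; first exact: (gauge_equiv_bc_related wallA wallAt gauge).
  by case=> V [beta rel]; apply: (related_gauge_equiv_bc wallA wallAt b rel).
split; [|split; [|split; [|split]]].
- by rewrite (gauge_equiv_bcF _ _ u ut); apply: equiv.
- exact: (equiv true).
- move=> V1 b1 V2 b2 rel1 rel2.
  have [b12 [psi [theta V2E]]] := related_unique wallA rel1 rel2.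
  by split=> //; exists psi, theta, 0; rewrite expiu0 mulmx1.
- move=> V b rel psi theta phi.
  exact: (related_expiu wallA wallAt psi theta phi rel).
- by move=> V b rel; apply: (related_wall wallA wallAt rel).
Qed.
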